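(* Let $\Sigma$ be a closed symmetric monoidal signature and consider a span $X \xleftarrow{f} Z \xrightarrow{g} Y$ in the category $\mathbf{EHyp}(\Sigma)$ of e-hypergraphs over $\Sigma$ such that: (1) $Z$ is a discrete e-hypergraph (it has no edges); (2) $[f_V(v_i)) = [f_V(v_j))$ and $[g_V(v_i)) = [g_V(v_j))$ for all vertices $v_i, v_j \in V_Z$; (3) for every $v \in V_Z$: if $[f_V(v)) \neq \varnothing$ then $[g_V(v)) = \varnothing$, and if $[g_V(v)) \neq \varnothing$ then $[f_V(v)) = \varnothing$; (4) ${\smile}(f_V(v_i)) = {\smile}(f_V(v_j))$ and ${\smile}(g_V(v_i)) = {\smile}(g_V(v_j))$ for all $v_i, v_j \in V_Z$. Then the pushout of $f$ and $g$ exists in $\mathbf{EHyp}(\Sigma)$.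
   Context: An e-hypergraph over $\Sigma = (\Sigma_O, \Sigma_M)$ is a tuple $\mathcal{G} = (V, E, s, t, l_V, l_E, <_e, <_c, {\smile})$ where $V$ is a finite set of vertices; $E$ is a finite set of hyperedges partitioned into ordinary edges, e-edges $E_e$ and closure edges $E_c$; $s, t : E \to V^*$ are source and target maps; $l_E : E \to \Sigma_M + \{\bot\}$ and $l_V$ label edges with operations and vertices with types, respecting operation typing; edges labelled $\bot$ are called hierarchical. There are immediate-predecessor relations $<^\mu_e \subseteq E_e \times (V+E)$ and $<^\mu_c \subseteq E_c \times (V+E)$ ($p <^\mu x$ means $p$ is the immediate parent of $x$), with $<_e$, $<_c$ their transitive closures, disjoint partial orders. For $x \in V+E$, $[x)$ denotes the set of all $x'$ reachable from $x$ by a chain of immediate predecessors (via either relation); $x$ is top-level if $[x) = \varnothing$. Requirements: all predecessors are hierarchical edges; each $x$ has at most one immediate predecessor; edges with no children are labelled (not $\bot$); the relations are closed under connectivity (if $v \in s(e)$ or $v \in t(e)$ then $p <^\mu e$ iff $p <^\mu v$). The consistency relation ${\smile}$ is the union over $p \in E_e$ of equivalence relations ${\smile}_p$ on $\{x \in V+E : p <^\mu_e x\}$, each closed under connectivity (if $v \in s(e)\cup t(e)$ and both are children of $p$ then $v \,{\smile}_p\, e$) and not the total relation on that set; ${\smile}(x)$ denotes the set of elements related to $x$ by ${\smile}$ (empty if $x$ is not a child of an e-edge). A morphism $\phi : \mathcal{F} \to \mathcal{G}$ of $\mathbf{EHyp}(\Sigma)$ is a pair $\phi_V : V_\mathcal{F}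 \to V_\mathcal{G}$, $\phi_E : E_\mathcal{F} \to E_\mathcal{G}$ such that: $\phi_V^*(s(e)) = s(\phi_E(e))$, $\phi_V^*(t(e)) = t(\phi_E(e))$ and labels are preserved; $\phi_E(E_{e,\mathcal{F}}) \subseteq E_{e,\mathcal{G}}$ and $\phi_E(E_{c,\mathcal{F}}) \subseteq E_{c,\mathcal{G}}$; immediate-predecessor relations $<^\mu_e$ and $<^\mu_c$ are preserved (if $p <^\mu x$ then $\phi(p) <^\mu \phi(x)$); and $x_1 {\smile} x_2$ implies $\phi(x_1) {\smile} \phi(x_2)$.
   Formalization: E-hypergraphs are required to have acyclic nesting for <_e and <_c taken together, not only for each separately; with alternating cycles allowed, distinct parents can have equal predecessor sets and the claim fails. *)

(* Defs.v *)
(* MathComp; boolp is used only for extensional equality of morphisms. *)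
From mathcomp Require Import all_boot.
From mathcomp Require Import boolp.

Set Implicit Arguments.
Unset Strict Implicit.
Unset Printing Implicit Defensive.

(** * Categories and pushouts *)

Record category : Type := Category {
  obj :> Type;
  hom : obj -> obj -> Type;
  idm : forall A : obj, hom A A;
  comp : forall A B C : obj, hom B C -> hom A B -> hom A C;
  comp1m : forall (A B : obj) (f : hom A B), comp (idm B) f = f;
  compm1 : forall (A B : obj) (f : hom A B), comp f (idm A) = f;
  compA : forall (A B C D : obj) (h : hom C D) (g : hom B C) (f : hom A B),
    comp h (comp g f) = comp (comp h g) f
}.

Definition is_pushout (C : category) (X Y Z P : C)
    (f : hom Z X) (g : hom Z Y) (i : hom X P) (j : hom Y P) : Prop :=
  comp i f = comp j g /\
  forall (W : C) (a : hom X W) (b : hom Y W), comp a f = comp b g ->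
    exists! h : hom P W, comp h i = a /\ comp h j = b.

Definition has_pushout (C : category) (X Y Z : C)
    (f : hom Z X) (g : hom Z Y) : Prop :=
  exists (P : C) (i : hom X P) (j : hom Y P), is_pushout f g i j.

(** * Closed symmetric monoidal signatures *)

(* A type of the (strict) closed symmetric monoidal language over O is a finite
   word of wires: the empty word is the unit and concatenation is the tensor.
   A wire is a basic type or an internal hom. *)
Inductive wire (O : Type) : Type :=
| Base of O
| Lolli of seq (wire O) & seq (wire O).

Record csm_signature : Type := CsmSignature {
  sig_obj : Type;
  sig_op : Type;
  op_dom : sig_op -> seq (wire sig_obj);
  op_cod : sig_op -> seq (wire sig_obj)
}.

(** * E-hypergraphs *)

Definition tclosure (T : finType) (r : rel T) : rel T :=
  fun x y => [exists z, r x z && connect r z y].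

Inductive edge_kind : Type := Ordinary | EEdge | CEdge.

Record ehyp_data (S : csm_signature) : Type := EHypData {
  vert : finType;
  edge : finType;
  src : edge -> seq vert;
  tgt : edge -> seq vert;
  vlab : vert -> wire (sig_obj S);
  elab : edge -> option (sig_op S);           (* None is the label bottom *)
  kind : edge -> edge_kind;
  epred : edge -> (vert + edge)%type -> bool; (* immediate predecessors *)
  cpred : edge -> (vert + edge)%type -> bool;
  sim : rel (vert + edge)%type
}.

Section EHypergraph.
Variables (S : csm_signature) (G : ehyp_data S).

Definition node : finType := (vert G + edge G)%type.

Definition ipred (p : edge G) (x : node) : bool := epred p x || cpred p x.

Definition on_nodes (r : edge G -> node -> bool) : rel node :=
  fun p x => if p is inr e then r e x else false.

Definition lt_e : rel node := tclosure (on_nodes (@epred S G)).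
Definition lt_c : rel node := tclosure (on_nodes (@cpred S G)).

(* [x), the elements from which x is reached by a nonempty chain of immediate
   predecessors of either sort. *)
Definition preds (x : node) : {set node} :=
  [set p | tclosure (on_nodes ipred) p x].

Definition simset (x : node) : {set node} := [set y | sim x y].

Record is_ehyp : Prop := IsEHyp {
  op_typing : forall (e : edge G) (m : sig_op S), elab e = Some m ->
    map (@vlab S G) (src e) = op_dom m /\ map (@vlab S G) (tgt e) = op_cod m;
  epred_kind : forall (p : edge G) (x : node), epred p x -> kind p = EEdge;
  cpred_kind : forall (p : edge G) (x : node), cpred p x -> kind p = CEdge;
  lt_e_irr : irreflexive lt_e;
  lt_c_irr : irreflexive lt_c;
  lt_disjoint : forall p x : node, ~ (lt_e p x /\ lt_c p x);
  (* Nesting is well-founded: e-edges and closure edges may alternate along a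
     chain, and irreflexivity of lt_e and lt_c alone would not exclude such an
     alternating chain from being a cycle. *)
  preds_irr : forall x : node, x \notin preds x;
  ipred_hier : forall (p : edge G) (x : node), ipred p x -> elab p = None;
  ipred_uniq : forall (p q : edge G) (x : node), ipred p x -> ipred q x -> p = q;
  childless_labelled : forall p : edge G,
    (forall x : node, ~ ipred p x) -> elab p <> None;
  epred_conn : forall (p e : edge G) (v : vert G),
    v \in src e \/ v \in tgt e -> epred p (inr e) = epred p (inl v);
  cpred_conn : forall (p e : edge G) (v : vert G),
    v \in src e \/ v \in tgt e -> cpred p (inr e) = cpred p (inl v);
  (* The relation sim_p is the restriction of sim to the children of p; these
     sets are disjoint for distinct p, so sim is the union of the sim_p exactly
     when sim only relates children of a common e-edge. *)
  sim_children : forall x y : node, sim x y ->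
    exists p : edge G, [/\ kind p = EEdge, epred p x & epred p y];
  sim_equiv : forall p : edge G, kind p = EEdge ->
    {in epred p & &, equivalence_rel (@sim S G)};
  sim_conn : forall (p e : edge G) (v : vert G), kind p = EEdge ->
    v \in src e \/ v \in tgt e -> epred p (inl v) -> epred p (inr e) ->
    sim (inl v) (inr e);
  sim_not_total : forall p : edge G, kind p = EEdge ->
    ~ (forall x y : node, epred p x -> epred p y -> sim x y)
}.

Definition discrete : Prop := #|edge G| = 0.

End EHypergraph.

Record ehypergraph (S : csm_signature) : Type := EHypergraph {
  ehyp_carrier :> ehyp_data S;
  ehyp_axioms : is_ehyp ehyp_carrier
}.

(** * The category EHyp *)

Section Morphisms.
Variable S : csm_signature.

Definition nmap (F G : ehyp_data S) (fV : vert F -> vert G)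
    (fE : edge F -> edge G) (x : node F) : node G :=
  match x with inl v => inl (fV v) | inr e => inr (fE e) end.

Record is_ehom (F G : ehyp_data S) (fV : vert F -> vert G)
    (fE : edge F -> edge G) : Prop := IsEHom {
  hom_src : forall e : edge F, map fV (src e) = src (fE e);
  hom_tgt : forall e : edge F, map fV (tgt e) = tgt (fE e);
  hom_vlab : forall v : vert F, vlab (fV v) = vlab v;
  hom_elab : forall e : edge F, elab (fE e) = elab e;
  hom_ekind : forall e : edge F, kind e = EEdge -> kind (fE e) = EEdge;
  hom_ckind : forall e : edge F, kind e = CEdge -> kind (fE e) = CEdge;
  hom_epred : forall (p : edge F) (x : node F),
    epred p x -> epred (fE p) (nmap fV fE x);
  hom_cpred : forall (p : edge F) (x : node F),
    cpred p x -> cpred (fE p) (nmap fV fE x);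
  hom_sim : forall x y : node F,
    sim x y -> sim (nmap fV fE x) (nmap fV fE y)
}.

Record ehom (F G : ehypergraph S) : Type := EHom {
  vmap : vert F -> vert G;
  emap : edge F -> edge G;
  ehom_axioms : is_ehom vmap emap
}.

Lemma ehomP (F G : ehypergraph S) (f g : ehom F G) :
  vmap f =1 vmap g -> emap f =1 emap g -> f = g.
Proof.
case: f g => [fV fE fP] [gV gE gP] /= /funext eV /funext eE.
by move: fP gP; rewrite eV eE => fP gP; rewrite (Prop_irrelevance fP gP).
Qed.

Lemma id_is_ehom (F : ehypergraph S) :
  is_ehom (fun v : vert F => v) (fun e : edge F => e).
Proof.
have nid (x : node F) : nmap (fun v : vert F => v) (fun e => e) x = x by case: x.
by split=> // *; rewrite ?map_id ?nid.
Qed.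

Definition ehom_id (F : ehypergraph S) : ehom F F := EHom (id_is_ehom F).

Lemma comp_is_ehom (F G H : ehypergraph S) (g : ehom G H) (f : ehom F G) :
  is_ehom (vmap g \o vmap f) (emap g \o emap f).
Proof.
case: f g => [fV fE fP] [gV gE gP] /=.
have nc (x : node F) : nmap (gV \o fV) (gE \o fE) x = nmap gV gE (nmap fV fE x).
  by case: x.
split=> /= *; rewrite ?nc.
- by rewrite map_comp (hom_src fP) (hom_src gP).
- by rewrite map_comp (hom_tgt fP) (hom_tgt gP).
- by rewrite (hom_vlab gP) (hom_vlab fP).
- by rewrite (hom_elab gP) (hom_elab fP).
- exact/(hom_ekind gP)/(hom_ekind fP).
- exact/(hom_ckind gP)/(hom_ckind fP).
- exact/(hom_epred gP)/(hom_epred fP).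
- exact/(hom_cpred gP)/(hom_cpred fP).
- exact/(hom_sim gP)/(hom_sim fP).
Qed.

Definition ehom_comp (F G H : ehypergraph S) (g : ehom G H) (f : ehom F G) :
  ehom F H := EHom (comp_is_ehom g f).

Definition EHyp : category.
Proof.
by refine (@Category (ehypergraph S) ehom ehom_id ehom_comp _ _ _);
  move=> *; apply: ehomP.
Defined.

End Morphisms.

(* Main.v *)
(* By (3) one leg, say f, lands in top-level vertices; by (2) and (4) all the
   vertices g v have the same parent p (or none) and the same consistency class.
   The pushout glues vertices and edges as sets.  Every connected component of X
   that meets the image of f is moved, as a whole, below p into the class of the
   g v, and all other parents and classes are kept.  This breaks no axiom because
   the moved elements had no parent in X and no node of Y gets a parent in X.  It
   is universal because parents and classes are constant along incidence in any
   e-hypergraph, so a cocone must send a moved component below the image of p,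
   into the class of the image of g v. *)
Require Import Defs.
From mathcomp Require Import all_boot boolp.

Set Implicit Arguments.
Unset Strict Implicit.
Unset Printing Implicit Defensive.

(** * Transitive closures and connectivity *)

Lemma connect_invariant (T : finType) (A : Type) (r : rel T) (m : T -> A) :
  (forall x y, r x y -> m x = m y) -> forall x y, connect r x y -> m x = m y.
Proof.
move=> mr x y /connectP[s]; elim: s x => [|z s IHs] x /=; first by move=> _ ->.
by case/andP=> /mr-> /IHs; apply.
Qed.

Section TClosure.
Variables (T : finType) (r : rel T).

Lemma tclosure_step x y z : connect r x y -> r y z -> tclosure r x z.
Proof.
case/connectP=> s; elim: s x => [|w s IHs] x /=.
  by move=> _ -> ryz; apply/existsP; exists z; rewrite ryz connect0.
case/andP=> rxw pws yE ryz; have /existsP[u /andP[rwu cuz]] := IHs w pws yE ryz.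
by apply/existsP; exists w; rewrite rxw (connect_trans (connect1 rwu) cuz).
Qed.

Lemma tclosure_last x y : tclosure r x y -> exists2 z, connect r x z & r z y.
Proof.
case/existsP=> z /andP[rxz /connectP[s]].
elim/last_ind: s => [_ ->|s w _]; first by exists x.
rewrite rcons_path last_rcons => /andP[pzs rw] ->; exists (last z s) => //.
by apply: connect_trans (connect1 rxz) _; apply/connectP; exists s.
Qed.

Lemma connect_tclosure x y : connect r x y -> x = y \/ tclosure r x y.
Proof.
case/connectP=> -[|z s] /=; first by left.
case/andP=> rxz pzs ->; right; apply/existsP; exists z; rewrite rxz.
by apply/connectP; exists s.
Qed.

Lemma tclosureW x y : tclosure r x y -> connect r x y.
Proof.
by case/tclosure_last=> z cxz rzy; apply: connect_trans cxz (connect1 rzy).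
Qed.

(** At [x = y] this yields acyclicity: a relation that strictly increases a rank has an irreflexive
    transitive closure. *)
Lemma tclosure_ltn (m : T -> nat) :
  (forall x y, r x y -> m x < m y) -> forall x y, tclosure r x y -> m x < m y.
Proof.
move=> mr x y /existsP[z /andP[/mr ltxz /connectP[s]]].
elim: s x z ltxz => [|w s IHs] x z ltxz /=; first by move=> _ ->.
by case/andP=> /mr ltzw; apply: IHs; apply: ltn_trans ltzw.
Qed.

End TClosure.

Lemma sub_tclosure (T : finType) (r r' : rel T) :
  subrel r r' -> subrel (tclosure r) (tclosure r').
Proof.
move=> sr x y /existsP[z /andP[/sr rxz czy]]; apply/existsP; exists z.
by rewrite rxz (connect_sub _ czy) // => u w /sr /connect1.
Qed.

(** * Pushouts of finite types *)

Section FinPushout.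
Variables (A B C : finType) (f : C -> A) (g : C -> B).

(** Symmetrised at once, so that [connect glue] is the equivalence generated by the span, and [root]
    selects one representative per class; [fpush] is the type of these representatives. *)
Definition glue : rel (A + B) :=
  fun u w => [exists c, (u == inl (f c)) && (w == inr (g c))
                     || (w == inl (f c)) && (u == inr (g c))].

Lemma glue_sym : connect_sym glue.
Proof.
apply: sym_connect_sym => u w.
by apply: eq_existsb => c; rewrite orbC.
Qed.

Definition fpush : finType := {u : A + B | root glue u == u}.

Definition fpush_class (u : A + B) : fpush :=
  exist _ (root glue u) (introT eqP (root_root glue_sym u)).

Definition fpush_inl (x : A) := fpush_class (inl x).
Definition fpush_inr (y : B) := fpush_class (inr y).

Definition cocase (T : Type) (a : A -> T) (b : B -> T) (u : A + B) : T :=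
  match u with inl x => a x | inr y => b y end.

Definition fpush_rec (T : Type) (a : A -> T) (b : B -> T) (v : fpush) : T :=
  cocase a b (val v).

Lemma fpush_glue c : fpush_inl (f c) = fpush_inr (g c).
Proof.
apply/val_inj/eqP; rewrite /= (root_connect glue_sym); apply: connect1.
by apply/existsP; exists c; rewrite !eqxx.
Qed.

Lemma fpushP (v : fpush) : (exists x, v = fpush_inl x) \/ (exists y, v = fpush_inr y).
Proof.
have -> : v = fpush_class (val v) by apply: val_inj; rewrite /= (eqP (valP v)).
by case: (val v) => [x|y]; [left; exists x | right; exists y].
Qed.

(** [fpush_rec] evaluates at the chosen representative; compatibility makes [cocase a b] constant
    along [glue], so the choice is immaterial. *)
Lemma fpush_recE (T : Type) (a : A -> T) (b : B -> T) :
  (forall c, a (f c) = b (g c)) ->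
  (fpush_rec a b \o fpush_inl =1 a) /\ (fpush_rec a b \o fpush_inr =1 b).
Proof.
move=> ab.
have recE u : fpush_rec a b (fpush_class u) = cocase a b u.
  apply/esym/(connect_invariant _ (connect_root glue u)) => x y /existsP[c].
  by case/orP=> /andP[/eqP-> /eqP->] /=; rewrite ab.
by split=> x; apply: recE.
Qed.

End FinPushout.

(** * E-hypergraphs presented by parents and consistency classes *)

Definition is_e (k : edge_kind) := if k is EEdge then true else false.
Definition is_c (k : edge_kind) := if k is CEdge then true else false.

Lemma is_eP k : reflect (k = EEdge) (is_e k).
Proof. by apply: (iffP idP); case: k. Qed.

Lemma is_cP k : reflect (k = CEdge) (is_c k).
Proof. by apply: (iffP idP); case: k. Qed.

(** * Parents and consistency classes in a given e-hypergraph *)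

Section Parents.
Variables (S : csm_signature) (G : ehypergraph S).
Let GP := ehyp_axioms G.
Implicit Types (x y : node G) (p e : edge G) (v : vert G).

(** Merges both predecessor relations into one partial function; the kind of the parent tells which
    of the two holds. *)
Definition parent (x : node G) : option (edge G) := [pick p | ipred p x].

Lemma parentP x p : parent x = Some p <-> ipred p x.
Proof.
rewrite /parent; case: pickP => [q px|nx]; last by rewrite nx.
by split=> [[<-] //|/(ipred_uniq GP px) ->].
Qed.

Lemma epredP p x : epred p x <-> parent x = Some p /\ kind p = EEdge.
Proof.
split=> [px|[/parentP/orP[] // /(cpred_kind GP)-> //]].
by split; [apply/parentP; rewrite /ipred px | apply: epred_kind px].
Qed.

Lemma cpredP p x : cpred p x <-> parent x = Some p /\ kind p = CEdge.
Proof.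
split=> [px|[/parentP/orP[] // /(epred_kind GP)-> //]].
by split; [apply/parentP; rewrite /ipred px orbT | apply: cpred_kind px].
Qed.

Lemma parent_kind x p : parent x = Some p -> kind p <> Ordinary.
Proof. by case/parentP/orP=> [/(epred_kind GP)->|/(cpred_kind GP)->]. Qed.

Lemma simP x y : sim x y <->
  exists p, [/\ parent x = Some p, parent y = Some p, kind p = EEdge
              & simset x = simset y].
Proof.
split=> [sxy|[p [px py pe eqs]]].
  have [p [pe px py]] := sim_children GP sxy; exists p.
  have [/epredP[-> _] /epredP[-> _]] := (px, py); split=> //.
  apply/setP=> z; rewrite !inE; have [pz|npz] := boolP (epred p z).
    by have [_ <-] := sim_equiv GP pe px py pz.
  (* Outside the children of [p] both sets are empty: anything related to a child of [p] has the
     same parent, by uniqueness of parents. *)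
  suff simN u : epred p u -> sim u z = false by rewrite !simN.
  move=> pu; apply/negP=> /(sim_children GP)[q [_ qu qz]]; case/negP: npz.
  by rewrite (@ipred_uniq _ _ GP p q u) ///ipred ?pu ?qu.
have: y \in simset y.
  have py' : epred p y by apply/epredP.
  by rewrite inE; case: (sim_equiv GP pe py' py' py').
by rewrite -eqs inE.
Qed.

Lemma parent_conn e v : v \in src e \/ v \in tgt e ->
  parent (inr e) = parent (inl v).
Proof.
move=> ve; apply: eq_pick => p.
by rewrite /ipred /= (epred_conn GP _ ve) (cpred_conn GP _ ve).
Qed.

Lemma simset_notin x : (forall p, ~~ epred p x) -> simset x = set0.
Proof.
move=> nx; apply/setP=> y; rewrite !inE; apply/negP.
by case/(sim_children GP)=> p [_ px _]; have := nx p; rewrite px.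
Qed.

(** Below an e-edge this is [sim_conn]; elsewhere both sets are empty. *)
Lemma simset_conn e v : v \in src e \/ v \in tgt e ->
  simset (inr e) = simset (inl v).
Proof.
move=> ve; case: (pickP (fun p : edge G => epred p (inl v))) => [p pv|nv].
  have pe : epred p (inr e) by rewrite (epred_conn GP _ ve).
  have /simP[q [_ _ _ //]] := sim_conn GP (epred_kind GP pv) ve pv pe.
rewrite !simset_notin // => p; first by rewrite nv.
by rewrite (epred_conn GP _ ve) nv.
Qed.

Lemma sim_class_neq p : kind p = EEdge ->
  exists x y, [/\ parent x = Some p, parent y = Some p & simset x <> simset y].
Proof.
move=> pe; have /existsP[x /existsP[y /and3P[px py nxy]]]:
    [exists x : node G, exists y, [&& epred p x, epred p y & ~~ sim x y]].
  apply: contraT => nt; case: (sim_not_total GP pe) => x y px py.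
  apply: contraNT nt => nxy; apply/existsP; exists x; apply/existsP; exists y.
  exact/and3P.
have [[px' _] [py' _]] := (iffLR (epredP p x) px, iffLR (epredP p y) py).
exists x, y; split=> // eqs; case/negP: nxy.
by apply/simP; exists p.
Qed.

(** The size of [preds] serves as nesting depth. It grows strictly because [inr p] precedes [x] but,
    by acyclicity, not itself. *)
Lemma card_preds_parent x p :
  parent x = Some p -> #|preds (inr p : node G)| < #|preds x|.
Proof.
move/parentP=> px; apply/proper_card/properP; split.
  apply/subsetP=> q; rewrite !inE => /tclosureW qp.
  exact: (@tclosure_step _ (on_nodes (@ipred S G)) _ (inr p)).
exists (inr p); last exact: (preds_irr GP).
by rewrite inE (@tclosure_step _ (on_nodes (@ipred S G)) _ (inr p)).
Qed.

Lemma preds0_parent x : preds x = set0 -> parent x = None.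
Proof.
case px: (parent x) => [p|//] x0.
by have := card_preds_parent px; rewrite x0 cards0.
Qed.

Lemma in_predsP q x : q \in preds x -> exists p,
  parent x = Some p /\ #|preds q| <= #|preds (inr p : node G)|.
Proof.
rewrite inE => /tclosure_last[[//|p] qp px]; exists p.
split; first exact/parentP.
case/connect_tclosure: qp => [->//|]; set m := fun y : node G => #|preds y|.
move=> qp; rewrite ltnW // (tclosure_ltn (m := m) _ qp) // => -[//|u] y uy.
exact/card_preds_parent/parentP.
Qed.

Lemma parent_in_preds x p : parent x = Some p -> inr p \in preds x.
Proof.
move/parentP=> px; rewrite inE.
exact: (@tclosure_step _ (on_nodes (@ipred S G)) _ (inr p)).
Qed.

(** The parent is the deepest predecessor, so the set of predecessors determines it. This turns the
    hypothesis on [preds] into one on parents. *)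
Lemma eq_preds_parent x y : preds x = preds y -> parent x = parent y.
Proof.
move=> exy; case px: (parent x) => [p|]; case py: (parent y) => [q|] //.
- have := parent_in_preds px; rewrite exy inE => /tclosure_last[[//|q']] pq'.
  move=> /parentP; rewrite py => -[eq]; move: pq'; rewrite -eq.
  case/connect_tclosure=> [[->] //|pq].
  have: inr p \in preds (inr q : node G) by rewrite inE.
  case/in_predsP=> r [/card_preds_parent rq pr].
  have := parent_in_preds py; rewrite -exy => /in_predsP[s []].
  by rewrite px => -[<-]; rewrite leqNgt (leq_ltn_trans pr rq).
- by have := parent_in_preds px; rewrite exy => /in_predsP[r []]; rewrite py.
- by have := parent_in_preds py; rewrite -exy => /in_predsP[r []]; rewrite px.
Qed.

End Parents.

(** * E-hypergraphs built from a parent function, class labels and a rank *)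

Section ParentData.
Variables (S : csm_signature) (V E : finType) (s t : E -> seq V).
Variables (vl : V -> wire (sig_obj S)) (el : E -> option (sig_op S)).
Variables (k : E -> edge_kind) (par : V + E -> option E).
Variables (C : eqType) (cls : V + E -> C) (rank : E -> nat).

Definition parent_data : ehyp_data S := {|
  vert := V; edge := E; src := s; tgt := t; vlab := vl; elab := el; kind := k;
  epred := fun p x => (par x == Some p) && is_e (k p);
  cpred := fun p x => (par x == Some p) && is_c (k p);
  sim := fun x y => [&& par x == par y, oapp (is_e \o k) false (par x)
                      & cls x == cls y] |}.

Hypothesis op_ok : forall e m, el e = Some m ->
  map vl (s e) = op_dom m /\ map vl (t e) = op_cod m.
Hypothesis par_kind : forall x p, par x = Some p -> k p <> Ordinary.
Hypothesis par_rank : forall e p, par (inr e) = Some p -> rank p < rank e.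
Hypothesis par_hier : forall x p, par x = Some p -> el p = None.
Hypothesis hier_par : forall p, el p = None -> exists x, par x = Some p.
Hypothesis conn : forall e v, v \in s e \/ v \in t e ->
  par (inr e) = par (inl v) /\ cls (inr e) = cls (inl v).
Hypothesis cls_neq : forall p, k p = EEdge ->
  exists x y, [/\ par x = Some p, par y = Some p & cls x <> cls y].

Lemma ipred_parent_data (p : E) (x : V + E) :
  ipred (G := parent_data) p x <-> par x = Some p.
Proof.
rewrite /ipred /= -andb_orr; split=> [/andP[/eqP]//|px].
by rewrite px eqxx; have := par_kind px; case: (k p).
Qed.

(** Uniqueness of parents, disjointness of the two orders and the equivalence axioms come for free,
    as [par] is a function and [sim] compares values. The rank gives acyclicity. *)
Lemma parent_data_ehyp : is_ehyp parent_data.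
Proof.
have irr x : ~~ tclosure (on_nodes (@ipred S parent_data)) x x.
  (* The rank is extended to vertices by one more than the rank of the parent, and by 0 at top
     level. *)
  pose m (x : V + E) := match x with
    | inl v => oapp (fun p => (rank p).+1) 0 (par x) | inr e => rank e end.
  apply/negP=> xx; suff: m x < m x by rewrite ltnn.
  apply: (tclosure_ltn _ xx) => -[//|p] y /ipred_parent_data.
  by case: y => [v /= ->|e /par_rank].
split=> //=.
- by move=> p x /andP[_ /is_eP].
- by move=> p x /andP[_ /is_cP].
- move=> x; apply: contraNF (irr x); apply: sub_tclosure => -[//|p] y py.
  by apply/orP; left.
- move=> x; apply: contraNF (irr x); apply: sub_tclosure => -[//|p] y py.
  by apply/orP; right.
- move=> p x [/tclosure_last[[//|q] _ /andP[/eqP qx /is_eP qe]]].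
  case/tclosure_last=> [[//|r] _ /andP[/eqP]]; rewrite qx => -[<-].
  by rewrite qe.
- by move=> x; rewrite inE.
- by move=> p x /ipred_parent_data/par_hier.
- by move=> p q x /ipred_parent_data px /ipred_parent_data; rewrite px => -[].
- by move=> p nch /hier_par[x /ipred_parent_data/nch].
- by move=> p e v /conn[-> _].
- by move=> p e v /conn[-> _].
- move=> x y /and3P[/eqP xy]; rewrite -xy; case: (par x) => //= p pe _.
  by exists p; rewrite eqxx pe; split=> //; apply/is_eP.
- move=> p pe x y z /andP[/eqP px _] /andP[/eqP py _] /andP[/eqP pz _].
  by rewrite px py pz /= pe !eqxx /=; split=> // /eqP->.
- move=> p e v pe /conn[-> ->] /andP[/eqP pv _] _.
  by rewrite pv /= pe !eqxx.
- move=> p pe tot; have [x [y [px py]]] := cls_neq pe; apply.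
  by have := tot x y; rewrite px py /= pe !eqxx => /(_ isT isT)/eqP.
Qed.

End ParentData.

(** * Morphisms in terms of parents *)

Lemma ehom_parent (S : csm_signature) (F G : ehypergraph S) (a : ehom F G) x p :
  parent x = Some p ->
  parent (nmap (vmap a) (emap a) x) = Some (emap a p).
Proof.
have aP := ehom_axioms a.
case/parentP/orP=> [/(hom_epred aP)/epredP[] | /(hom_cpred aP)/cpredP[]] //.
Qed.

(** Once parents and the kinds of non-ordinary edges are preserved, both predecessor conditions
    follow, and related nodes already have images below a common e-edge; only equality of classes
    remains. *)
Lemma is_ehom_parent (S : csm_signature) (F G : ehypergraph S)
    (fV : vert F -> vert G) (fE : edge F -> edge G) :
  (forall e, map fV (src e) = src (fE e)) ->
  (forall e, map fV (tgt e) = tgt (fE e)) ->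
  (forall v, vlab (fV v) = vlab v) -> (forall e, elab (fE e) = elab e) ->
  (forall e, kind e <> Ordinary -> kind (fE e) = kind e) ->
  (forall (x : node F) p, parent x = Some p ->
     parent (nmap fV fE x : node G) = Some (fE p)) ->
  (forall x y : node F, sim x y ->
     simset (nmap fV fE x : node G) = simset (nmap fV fE y)) ->
  is_ehom fV fE.
Proof.
move=> hs ht hv hl hk hp hsim; split=> //.
- by move=> e ek; rewrite hk ek.
- by move=> e ek; rewrite hk ek.
- by move=> p x /epredP[/hp px pe]; apply/epredP; rewrite px hk pe.
- by move=> p x /cpredP[/hp px pe]; apply/cpredP; rewrite px hk pe.
- move=> x y sxy; have /simP[p [px py pe _]] := sxy; apply/simP.
  by exists (fE p); rewrite (hp _ _ px) (hp _ _ py) hk pe //; split=> //; apply: hsim.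
Qed.

(** * Attaching a top-level interface below a common parent *)

Section Attach.
Variables (S : csm_signature) (X Y Z : ehypergraph S).
Variables (f : ehom Z X) (g : ehom Z Y).
Hypothesis Z_discrete : discrete Z.
Hypothesis f_top : forall v, parent (inl (vmap f v) : node X) = None.
Hypothesis g_parent_const : forall v w,
  parent (inl (vmap g v) : node Y) = parent (inl (vmap g w)).
Hypothesis g_simset_const : forall v w,
  simset (inl (vmap g v) : node Y) = simset (inl (vmap g w)).

Implicit Types (x : node X) (y : node Y).

(** * Connected components of [X] meeting the interface *)

Definition incident : rel (node X) := fun u w =>
  match u, w with
  | inl v, inr e | inr e, inl v => (v \in src e) || (v \in tgt e)
  | _, _ => false
  end.

(** The instances used are [parent], [simset], [attached], functions built from them, and pullbacks
    of [parent] and [simset] along a morphism. *)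
Definition conn_invariant (A : Type) (m : node X -> A) :=
  forall e v, v \in src e \/ v \in tgt e -> m (inr e) = m (inl v).

Definition attached x := [exists v, connect incident x (inl (vmap f v))].

Lemma attached_invariant (A : Type) (m : node X -> A) x :
  conn_invariant m -> attached x -> exists v, m x = m (inl (vmap f v)).
Proof.
move=> mc /existsP[v xv]; exists v; apply: connect_invariant xv.
by move=> [u|e] [w|e'] //= /orP /mc.
Qed.

Lemma attached_conn : conn_invariant attached.
Proof.
move=> e v /orP ve; apply: eq_existsb => w.
have inc_sym : connect_sym incident by apply: sym_connect_sym => -[u|?] [u'|?].
apply: same_connect => //; exact: connect1.
Qed.

Lemma attached_f v : attached (inl (vmap f v)).
Proof. by apply/existsP; exists v; apply: connect0. Qed.

Lemma attached_top x : attached x -> parent x = None.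
Proof.
by case/(attached_invariant (@parent_conn _ X))=> v ->; apply: f_top.
Qed.

(** The default is reached only when [Z] has no vertices, and then no node is attached; the same
    goes for [g_simset]. *)
Definition g_parent : option (edge Y) :=
  oapp (fun v => parent (inl (vmap g v) : node Y)) None [pick v : vert Z].

Definition g_simset : {set node Y} :=
  oapp (fun v => simset (inl (vmap g v) : node Y)) set0 [pick v : vert Z].

Lemma g_parentE v : g_parent = parent (inl (vmap g v) : node Y).
Proof.
by rewrite /g_parent; case: pickP => [w _|/(_ v)//]; apply: g_parent_const.
Qed.

Lemma g_simsetE v : g_simset = simset (inl (vmap g v) : node Y).
Proof.
by rewrite /g_simset; case: pickP => [w _|/(_ v)//]; apply: g_simset_const.
Qed.

(** * Nodes of the pushout and functions on them *)

Notation V := (fpush (vmap f) (vmap g)).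
Notation E := (edge X + edge Y)%type.

Definition po_inl x : V + E :=
  match x with inl v => inl (fpush_inl _ _ v) | inr e => inr (inl e) end.

Definition po_inr y : V + E :=
  match y with inl v => inl (fpush_inr _ _ v) | inr e => inr (inr e) end.

Definition po_rec (T : Type) (a : node X -> T) (b : node Y -> T) (z : V + E) : T :=
  match z with
  | inl v => fpush_rec (a \o inl) (b \o inl) v
  | inr e => cocase (a \o inr) (b \o inr) e
  end.

Lemma po_rec_inl (T : Type) (a : node X -> T) (b : node Y -> T) x :
  (forall v, a (inl (vmap f v)) = b (inl (vmap g v))) ->
  po_rec a b (po_inl x) = a x.
Proof.
case: x => [v ab|//]; have [+ _] := @fpush_recE _ _ _ _ _ _ (a \o inl) (b \o inl) ab.
exact.
Qed.

Lemma po_rec_inr (T : Type) (a : node X -> T) (b : node Y -> T) y :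
  (forall v, a (inl (vmap f v)) = b (inl (vmap g v))) ->
  po_rec a b (po_inr y) = b y.
Proof.
case: y => [v ab|//]; have [_] := @fpush_recE _ _ _ _ _ _ (a \o inl) (b \o inl) ab.
exact.
Qed.

(* An attached node behaves, for every connectivity invariant, like a node of Y
   on the interface; this is what makes the relations added to it universal. *)
Lemma po_nodeP (z : V + E) :
  (exists2 x, z = po_inl x & ~~ attached x) \/
  (exists y, forall (T : Type) (a : node X -> T) (b : node Y -> T),
     conn_invariant a -> (forall v, a (inl (vmap f v)) = b (inl (vmap g v))) ->
     po_rec a b z = b y).
Proof.
have zP : (exists x, z = po_inl x) \/ (exists y, z = po_inr y).
  case: z => [v|[e|e]]; last by right; exists (inr e).
    case: (fpushP v) => [[w ->]|[w ->]]; first by left; exists (inl w).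
    by right; exists (inl w).
  by left; exists (inr e).
case: zP => [[x ->]|[y ->]]; last by right; exists y => T a b _ /po_rec_inr.
have [/existsP[v xv]|] := boolP (attached x); [right | by left; exists x].
exists (inl (vmap g v)) => T a b ac ab; rewrite po_rec_inl // -ab.
by apply: connect_invariant xv => -[u|e] [w|e'] //= /orP /ac.
Qed.

Definition parX x : option E :=
  if attached x then omap inr g_parent else omap inl (parent x).
(** The sum keeps classes of [X] and [Y] apart; the tag [inr] on attached nodes merges them into the
    class of the interface in [Y]. *)
Definition clsX x : {set node X} + {set node Y} :=
  if attached x then inr g_simset else inl (simset x).
Definition parY y : option E := omap inr (parent y).
Definition clsY y : {set node X} + {set node Y} := inr (simset y).

Definition po_par := po_rec parX parY.
Definition po_cls := po_rec clsX clsY.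

Lemma parX_conn : conn_invariant parX.
Proof. by move=> e v ve; rewrite /parX (attached_conn ve) (parent_conn ve). Qed.

Lemma clsX_conn : conn_invariant clsX.
Proof. by move=> e v ve; rewrite /clsX (attached_conn ve) (simset_conn ve). Qed.

Lemma parXY v : parX (inl (vmap f v)) = parY (inl (vmap g v)).
Proof. by rewrite /parX attached_f (g_parentE v). Qed.

Lemma clsXY v : clsX (inl (vmap f v)) = clsY (inl (vmap g v)).
Proof. by rewrite /clsX attached_f (g_simsetE v). Qed.

Lemma po_parX x : po_par (po_inl x) = parX x.
Proof. exact/po_rec_inl/parXY. Qed.

Lemma po_clsX x : po_cls (po_inl x) = clsX x.
Proof. exact/po_rec_inl/clsXY. Qed.

Lemma po_parY y : po_par (po_inr y) = parY y.
Proof. exact/po_rec_inr/parXY. Qed.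

Lemma po_clsY y : po_cls (po_inr y) = clsY y.
Proof. exact/po_rec_inr/clsXY. Qed.

Lemma parX_parent x p : parent x = Some p -> ~~ attached x.
Proof. by move=> px; apply/negP=> /attached_top; rewrite px. Qed.

(** * The pushout object *)

Definition po_src (e : E) : seq V :=
  cocase (map (@fpush_inl _ _ _ _ _) \o @src _ X)
         (map (@fpush_inr _ _ _ _ _) \o @src _ Y) e.
Definition po_tgt (e : E) : seq V :=
  cocase (map (@fpush_inl _ _ _ _ _) \o @tgt _ X)
         (map (@fpush_inr _ _ _ _ _) \o @tgt _ Y) e.
Definition po_kind : E -> edge_kind := cocase (@kind _ X) (@kind _ Y).
Definition po_elab : E -> option (sig_op S) := cocase (@elab _ X) (@elab _ Y).
Definition po_vlab : V -> wire (sig_obj S) := fpush_rec (@vlab _ X) (@vlab _ Y).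

(** An edge of [X] only has children that are unattached nodes of [X]. An edge of [Y] may have
    gained attached nodes of [X], so the second case only provides some child in [Y]. *)
Lemma po_parP z p : po_par z = Some p ->
  (exists x q, [/\ z = po_inl x, p = inl q & parent x = Some q]) \/
  (exists y q, p = inr q /\ parent y = Some q).
Proof.
case: (po_nodeP z) => [[x -> nx]|[y zy]].
  rewrite po_parX /parX (negbTE nx); case px: (parent x) => [q|] //= [<-].
  by left; exists x, q.
rewrite /po_par (zy _ _ _ parX_conn parXY) /parY.
by case py: (parent y) => [q|] //= [<-]; right; exists y, q.
Qed.

Lemma po_par_inl x p : parent x = Some p -> po_par (po_inl x) = Some (inl p).
Proof.
by move=> px; rewrite po_parX /parX (negbTE (parX_parent px)) px.
Qed.

Lemma po_par_inr y p : parent y = Some p -> po_par (po_inr y) = Some (inr p).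
Proof. by move=> py; rewrite po_parY /parY py. Qed.

Lemma po_cls_inl x p : parent x = Some p -> po_cls (po_inl x) = inl (simset x).
Proof.
by move=> px; rewrite po_clsX /clsX (negbTE (parX_parent px)).
Qed.

Lemma po_vlabE :
  (po_vlab \o fpush_inl _ _ =1 @vlab _ X) /\ (po_vlab \o fpush_inr _ _ =1 @vlab _ Y).
Proof.
apply: fpush_recE => v.
by rewrite (hom_vlab (ehom_axioms f)) (hom_vlab (ehom_axioms g)).
Qed.

(* Only edges of X can acquire a parent in Y, so X is ranked above all of Y. *)
Definition po_rank (e : E) : nat :=
  match e with
  | inl e => #|node Y| + #|preds (inr e : node X)|.+1
  | inr e => #|preds (inr e : node Y)|
  end.

Definition po_data : ehyp_data S :=
  parent_data po_src po_tgt po_vlab po_elab po_kind po_par po_cls.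

Lemma po_ehyp : is_ehyp po_data.
Proof.
have [vX vY] := po_vlabE.
apply: (parent_data_ehyp (rank := po_rank)).
- move=> [e|e] m /= em; rewrite -!map_comp.
    by rewrite !(eq_map vX); apply: op_typing (ehyp_axioms X) _ _ em.
  by rewrite !(eq_map vY); apply: op_typing (ehyp_axioms Y) _ _ em.
- move=> z p /po_parP[[x [q [_ ->]]]|[y [q [->]]]]; exact: parent_kind.
- move=> [e|e] p; rewrite /po_par /=.
    rewrite /parX; case: ifP => _.
      case: g_parent => [q|] //= [<-] /=.
      (* The parent lies in [Y], where ranks are at most [#|node Y|]; the successor in [po_rank]
         makes the inequality strict. *)
      by rewrite addnS ltnS (leq_trans (max_card _)) // leq_addr.
    case pe: (parent _) => [q|] //= [<-] /=.
    by rewrite ltn_add2l ltnS; apply: card_preds_parent pe.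
  rewrite /parY; case pe: (parent _) => [q|] //= [<-] /=.
  exact: card_preds_parent pe.
- by move=> z p /po_parP[[x [q [_ -> /parentP]]]|[y [q [-> /parentP]]]];
    [apply: (ipred_hier (ehyp_axioms X)) | apply: (ipred_hier (ehyp_axioms Y))].
(* Hierarchical edges keep their children: a node with a parent in [X] is not attached. *)
- move=> [p|p] /= pN; apply: contrapT => nch.
    apply: (childless_labelled (ehyp_axioms X) _ pN) => x /parentP px.
    by apply: nch; exists (po_inl x); apply: po_par_inl.
  apply: (childless_labelled (ehyp_axioms Y) _ pN) => y /parentP py.
  by apply: nch; exists (po_inr y); apply: po_par_inr.
- move=> [e|e] v /= ve.
    have [w we ->]: exists2 w, w \in src e \/ w \in tgt e & v = fpush_inl _ _ w.
      by case: ve => /mapP[w we ->]; exists w; [left| |right|].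
    suff: po_par (po_inl (inr e)) = po_par (po_inl (inl w)) /\
          po_cls (po_inl (inr e)) = po_cls (po_inl (inl w)) by [].
    by rewrite !po_parX !po_clsX (parX_conn we) (clsX_conn we).
  have [w we ->]: exists2 w, w \in src e \/ w \in tgt e & v = fpush_inr _ _ w.
    by case: ve => /mapP[w we ->]; exists w; [left| |right|].
  suff: po_par (po_inr (inr e)) = po_par (po_inr (inl w)) /\
        po_cls (po_inr (inr e)) = po_cls (po_inr (inl w)) by [].
  by rewrite !po_parY !po_clsY /parY /clsY (parent_conn we) (simset_conn we).
(* Attaching only adds children below [p], so two original children in different classes still
   witness that [sim] is not total there. *)
- move=> [p|p] /= /sim_class_neq[x [y [px py nxy]]].
    exists (po_inl x), (po_inl y); split; try exact: po_par_inl.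
    by rewrite (po_cls_inl px) (po_cls_inl py) => -[].
  exists (po_inr x), (po_inr y); split; try exact: po_par_inr.
  by rewrite !po_clsY => -[].
Qed.

Definition po : ehypergraph S := EHypergraph po_ehyp.

Lemma po_parentE (z : node po) : parent z = po_par z.
Proof.
apply/eqP; case pz: (po_par z) => [p|].
  apply/eqP/parentP; apply/ipred_parent_data => //.
  by move=> u q /po_parP[[x [r [_ ->]]]|[y [r [->]]]]; apply: parent_kind.
case qz: (parent z) => [q|] //; move: qz => /parentP.
by rewrite /ipred /= pz.
Qed.

Lemma po_simP (z w : node po) : sim z w <->
  exists p, [/\ po_par z = Some p, po_par w = Some p, po_kind p = EEdge
              & po_cls z = po_cls w].
Proof.
split=> [/and3P[/eqP zw]|[p [pz pw pe zw]]].
  case pz: (po_par z) => [p|] //= /is_eP pe /eqP czw.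
  by exists p; rewrite -zw.
by rewrite /= pz pw /= pe zw !eqxx.
Qed.

(** * The two legs into the pushout object *)

Lemma po_inl_is_ehom :
  @is_ehom S X po (fun v => fpush_inl (vmap f) (vmap g) v) inl.
Proof.
apply: is_ehom_parent => //; first exact: po_vlabE.1.
  by move=> x p /po_par_inl; rewrite po_parentE; case: x.
move=> x y sxy; have /simP[p [px py pe exy]] := sxy.
(* Equality of [simset] in [po] is required, whereas [po_cls] holds labels inherited from [X] and
   [Y]; passing through [sim] converts one into the other. *)
suff /simP[_ [_ _ _]] : sim (po_inl x : node po) (po_inl y).
  by case: x y {sxy px py exy} => [?|?] [].
apply/po_simP; exists (inl p).
by rewrite (po_par_inl px) (po_par_inl py) (po_cls_inl px) (po_cls_inl py) exy.
Qed.

Lemma po_inr_is_ehom :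
  @is_ehom S Y po (fun v => fpush_inr (vmap f) (vmap g) v) inr.
Proof.
apply: is_ehom_parent => //; first exact: po_vlabE.2.
  by move=> x p /po_par_inr; rewrite po_parentE; case: x.
move=> x y sxy; have /simP[p [px py pe exy]] := sxy.
suff /simP[_ [_ _ _]] : sim (po_inr x : node po) (po_inr y).
  by case: x y {sxy px py exy} => [?|?] [].
apply/po_simP; exists (inr p).
by rewrite (po_par_inr px) (po_par_inr py) !po_clsY /clsY exy.
Qed.

Definition po_hom_inl : ehom X po := EHom po_inl_is_ehom.
Definition po_hom_inr : ehom Y po := EHom po_inr_is_ehom.

(** * The mediating morphism *)

Section Mediating.
Variables (W : ehypergraph S) (a : ehom X W) (b : ehom Y W).
Hypothesis ab : forall v, vmap a (vmap f v) = vmap b (vmap g v).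

Let hV : vert po -> vert W := fpush_rec (vmap a) (vmap b).
Let hE : edge po -> edge W := cocase (emap a) (emap b).

Lemma po_hV : (forall v, hV (fpush_inl _ _ v) = vmap a v) /\
  (forall v, hV (fpush_inr _ _ v) = vmap b v).
Proof. exact: fpush_recE. Qed.

Lemma conn_invariant_hom (T : Type) (m : node W -> T) :
  (forall e v, v \in src e \/ v \in tgt e -> m (inr e) = m (inl v)) ->
  conn_invariant (m \o nmap (vmap a) (emap a)).
Proof.
move=> mc e v ve; apply: mc.
rewrite -(hom_src (ehom_axioms a)) -(hom_tgt (ehom_axioms a)).
by case: ve => /(map_f (vmap a)); [left | right].
Qed.

(** This is where universality is forced: parents and classes in [W] are constant along incidence,
    so the image of an attached node has the same parent and class as the image of the interface. *)
Lemma po_node_rep (z : node po) :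
  (exists2 x, z = po_inl x & ~~ attached x) \/
  (exists y, [/\ po_par z = parY y, po_cls z = clsY y,
     parent (nmap hV hE z) = parent (nmap (vmap b) (emap b) y) &
     simset (nmap hV hE z) = simset (nmap (vmap b) (emap b) y)]).
Proof.
case: (po_nodeP z) => [|[y zy]]; [by left | right; exists y].
(* Any function on nodes of [W], composed with the candidate map, is again of the form [po_rec], so
   [zy] applies to it. *)
have hz T (m : node W -> T) : m (nmap hV hE z) =
    po_rec (m \o nmap (vmap a) (emap a)) (m \o nmap (vmap b) (emap b)) z.
  by case: z {zy} => [v|[e|e]] //=; rewrite /hV /fpush_rec; case: (val v).
split; [exact: zy parX_conn parXY | exact: zy clsX_conn clsXY | |].
- rewrite (hz _ (@parent _ W)); apply: zy => [|v]; last by rewrite /= ab.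
  exact/conn_invariant_hom/parent_conn.
- rewrite (hz _ (@simset _ W)); apply: zy => [|v]; last by rewrite /= ab.
  exact/conn_invariant_hom/simset_conn.
Qed.

Lemma nmap_inl x : nmap hV hE (po_inl x) = nmap (vmap a) (emap a) x.
Proof. by case: x => [v|//] /=; rewrite po_hV.1. Qed.

Lemma mediating_is_ehom : is_ehom hV hE.
Proof.
have [hl hr] := po_hV.
have [aP bP] := (ehom_axioms a, ehom_axioms b).
apply: is_ehom_parent.
- move=> [e|e] /=; rewrite -map_comp.
    by rewrite (eq_map hl) (hom_src aP).
  by rewrite (eq_map hr) (hom_src bP).
- move=> [e|e] /=; rewrite -map_comp.
    by rewrite (eq_map hl) (hom_tgt aP).
  by rewrite (eq_map hr) (hom_tgt bP).
- move=> v; case: (fpushP v) => [[w ->]|[w ->]].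
    by rewrite hl (hom_vlab aP) -(po_vlabE.1 w).
  by rewrite hr (hom_vlab bP) -(po_vlabE.2 w).
- by move=> [e|e] /=; [apply: hom_elab aP _ | apply: hom_elab bP _].
- move=> [e|e] /=; case ek: (kind e) => // _.
  + exact: hom_ekind aP _ ek.
  + exact: hom_ckind aP _ ek.
  + exact: hom_ekind bP _ ek.
  + exact: hom_ckind bP _ ek.
- move=> z p; rewrite po_parentE.
  case: (po_node_rep z) => [[x -> nx]|[y [-> _ -> _]]].
    rewrite nmap_inl po_parX /parX (negbTE nx); case px: (parent x) => [q|] //= [<-].
    exact: ehom_parent px.
  by rewrite /parY; case py: (parent y) => [q|] //= [<-]; apply: ehom_parent.
- move=> z w /po_simP[p [pz pw pe]].
  (* Mixed pairs are excluded by the tags of the classes. Otherwise both nodes are represented in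
     one of [X] and [Y], with a common parent and equal classes, and [a] or [b] preserves [sim]
     there. *)
  case: (po_node_rep z) pz => [[x -> nx]|[y [-> -> _ ->]]].
    rewrite nmap_inl po_parX po_clsX /parX /clsX (negbTE nx).
    case px: (parent x) => [q|] //= [eqp].
    case: (po_node_rep w) pw => [[x' -> nx']|[y' [_ -> _ _]]] //.
    rewrite nmap_inl po_parX po_clsX /parX /clsX (negbTE nx').
    case px': (parent x') => [q'|] //= [eqp'].
    move=> [exx']; move: eqp' pe; rewrite -eqp => -[eqq] qe.
    have /(hom_sim aP)/simP[? []//] : sim x x'.
    by apply/simP; exists q; rewrite px px' eqq.
  rewrite /parY; case py: (parent y) => [q|] //= [eqp].
  case: (po_node_rep w) pw => [[x' -> nx']|[y' [-> -> _ ->]]].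
    by rewrite po_clsX /clsX (negbTE nx').
  rewrite /parY; case py': (parent y') => [q'|] //= [eqp'] [eyy'].
  move: eqp' pe; rewrite -eqp => -[eqq] qe.
  have /(hom_sim bP)/simP[? []//] : sim y y'.
  by apply/simP; exists q; rewrite py py' eqq.
Qed.

Definition mediating : ehom po W := EHom mediating_is_ehom.

End Mediating.

(** Uniqueness holds because the vertices and edges of [X] and [Y] cover those of [po]. *)
Lemma attach_pushout : @has_pushout (EHyp S) X Y Z f g.
Proof.
exists po, po_hom_inl, po_hom_inr; split.
  apply: ehomP => [v|e] /=; first exact: fpush_glue.
  by have := card0_eq Z_discrete e.
move=> W a b eqab.
have ab v : vmap a (vmap f v) = vmap b (vmap g v).
  by have := congr1 (fun h : ehom Z W => vmap h v) eqab.
have [hl hr] := po_hV ab.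
exists (mediating ab); split; first by split; apply: ehomP.
move=> h [ha hb]; apply: ehomP.
  by move=> v; case: (fpushP v) => -[w ->]; rewrite /= ?hl ?hr -?ha -?hb.
by move=> [e|e] /=; rewrite -?ha -?hb.
Qed.

End Attach.

(** * Symmetry of the span and the general case *)

Lemma has_pushout_sym (C : category) (X Y Z : C) (f : hom Z X) (g : hom Z Y) :
  has_pushout f g -> has_pushout g f.
Proof.
case=> P [i [j [ij univ]]]; exists P, j, i; split=> // W a b ab.
have [h [[hi hj] huniq]] := univ W b a (esym ab).
by exists h; split=> // h' [hj' hi']; apply: huniq.
Qed.

Theorem theorem2 (S : csm_signature) (X Y Z : EHyp S)
  (f : @hom (EHyp S) Z X) (g : @hom (EHyp S) Z Y)
  (Zdiscrete : discrete Z)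
  (same_preds : forall vi vj : vert Z,
     preds (inl (vmap f vi)) = preds (inl (vmap f vj)) /\
     preds (inl (vmap g vi)) = preds (inl (vmap g vj)))
  (one_top : forall v : vert Z,
     (preds (inl (vmap f v)) <> set0 -> preds (inl (vmap g v)) = set0) /\
     (preds (inl (vmap g v)) <> set0 -> preds (inl (vmap f v)) = set0))
  (same_sim : forall vi vj : vert Z,
     simset (inl (vmap f vi)) = simset (inl (vmap f vj)) /\
     simset (inl (vmap g vi)) = simset (inl (vmap g vj))) :
  has_pushout f g.
Proof.
(* The alternative [one_top] is pointwise; [same_preds] makes it uniform, since one nested [f v]
   forces [g v], and with it every [g w], to top level. *)
have [f_top|g_top] : (forall v, preds (inl (vmap f v)) = set0) \/
    (forall v, preds (inl (vmap g v)) = set0).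
- case: (pickP (fun v : vert Z => preds (inl (vmap f v)) != set0)) => [v /eqP fv|ftop].
    right=> w; have [_ ->] := same_preds w v; exact: (one_top v).1.
  by left=> v; apply/eqP/negbFE/ftop.
- apply: attach_pushout => // [v|v w|v w]; first exact: preds0_parent.
    exact/eq_preds_parent/(same_preds v w).2.
  exact: (same_sim v w).2.
- apply/has_pushout_sym/attach_pushout => // [v|v w|v w]; first exact: preds0_parent.
    exact/eq_preds_parent/(same_preds v w).1.
  exact: (same_sim v w).1.
Qed.
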